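(* Let $L$ be a loop with holomorph $H(L)$. Then $L$ is a WIP-SWIPL if and only if $H(L)$ is a WIP-SWIPL.
   Context: A loop is a weak inverse property loop (WIPL) if $x\cdot(y\cdot x)^{\rho}=y^{\rho}$ for all $x,y$, where $x^{\rho}$ is the right inverse of $x$, i.e. $x\cdot x^{\rho}=e$ with $e$ the identity element. A loop is a Smarandache weak inverse property loop (SWIPL) if it has at least one non-trivial subloop that is a WIPL. A WIP-SWIPL is a loop that is both a WIPL and a SWIPL. Mappings are written on the right, so $\alpha\beta$ means first $\alpha$, then $\beta$. For a loop $(L,\cdot)$ let $Aum(L,\cdot)$ be its automorphism group. The holomorph $H(L)=(H,\circ)$ is the loop on the set $H$ of pairs $(\alpha,x)$ with $\alpha\in Aum(L,\cdot)$, $x\in L$, with operation $(\alpha,x)\circ(\beta,y)=(\alpha\beta,\ x\beta\cdot y)$. *)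

(* Defs.v *)
From HB Require Import structures.
From mathcomp Require Import all_boot.
From mathcomp Require Import boolp classical_sets.

Set Implicit Arguments.
Unset Strict Implicit.
Unset Printing Implicit Defensive.

Local Open Scope group_scope.
Local Open Scope classical_set_scope.

HB.mixin Record UMagma_isLoop L of UMagma L := {
  loop_eqr : forall a b : L, exists! x : L, a * x = b;
  loop_eql : forall a b : L, exists! y : L, y * a = b
}.

#[short(type="loopType")]
HB.structure Definition Loop := {L of UMagma_isLoop L & UMagma L}.

Lemma loop_mulgI (L : loopType) (a x y : L) : a * x = a * y -> x = y.
Proof.
by move=> axy; have [z [_ zU]] := loop_eqr a (a * y); rewrite -(zU x) // -(zU y).
Qed.

Lemma loop_mulIg (L : loopType) (a x y : L) : x * a = y * a -> x = y.
Proof.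
by move=> xya; have [z [_ zU]] := loop_eql a (y * a); rewrite -(zU x) // -(zU y).
Qed.

Definition rinv (L : loopType) (x : L) : L := projT1 (cid (loop_eqr x 1)).

Lemma mulg_rinv (L : loopType) (x : L) : x * rinv x = 1.
Proof. by rewrite /rinv; case: cid => z []. Qed.

Definition WIPL (L : loopType) : Prop :=
  forall x y : L, x * rinv (y * x) = rinv y.

(* A subset that is a loop under the induced operation; uniqueness of the
   solutions, and the fact that the identity is that of L, come from L. *)
Record subloop (L : loopType) := Subloop {
  subloop_set :> set L;
  subloop1 : subloop_set 1;
  subloopM : forall x y, subloop_set x -> subloop_set y -> subloop_set (x * y);
  subloop_eqr : forall a b, subloop_set a -> subloop_set b ->
    exists2 x, subloop_set x & a * x = b;
  subloop_eql : forall a b, subloop_set a -> subloop_set b ->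
    exists2 y, subloop_set y & y * a = b
}.

Definition subloop_type (L : loopType) (S : subloop L) : Type :=
  {x : L | x \in (S : set L)}.

Section SubloopIsLoop.
Variables (L : loopType) (S : subloop L).
Local Notation T := (subloop_type S).

HB.instance Definition _ := Choice.on T.

Definition sub_one : T := exist _ 1 (mem_set (subloop1 S)).

Definition sub_mul (x y : T) : T :=
  exist _ (val x * val y)
    (mem_set (subloopM (set_mem (valP x)) (set_mem (valP y)))).

Fact sub_mul1g : left_id sub_one sub_mul.
Proof. by move=> x; apply: val_inj; rewrite /= mul1g. Qed.

Fact sub_mulg1 : right_id sub_one sub_mul.
Proof. by move=> x; apply: val_inj; rewrite /= mulg1. Qed.

HB.instance Definition _ := hasMul.Build T sub_mul.
HB.instance Definition _ := hasOne.Build T sub_one.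
HB.instance Definition _ := BaseUMagma_isUMagma.Build T sub_mul1g sub_mulg1.

Fact sub_eqr (a b : T) : exists! x : T, a * x = b.
Proof.
have [x Sx axb] := subloop_eqr (set_mem (valP a)) (set_mem (valP b)).
exists (exist _ x (mem_set Sx)); split; first exact: val_inj.
move=> y /(congr1 val) /= ayb; apply: val_inj => /=.
exact: (@loop_mulgI L (val a) _ _ (etrans axb (esym ayb))).
Qed.

Fact sub_eql (a b : T) : exists! y : T, y * a = b.
Proof.
have [x Sx xab] := subloop_eql (set_mem (valP a)) (set_mem (valP b)).
exists (exist _ x (mem_set Sx)); split; first exact: val_inj.
move=> y /(congr1 val) /= yab; apply: val_inj => /=.
exact: (@loop_mulIg L (val a) _ _ (etrans xab (esym yab))).
Qed.

HB.instance Definition _ := UMagma_isLoop.Build T sub_eqr sub_eql.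
End SubloopIsLoop.

(* Non-trivial means different from {1}; L itself is allowed. *)
Definition nontrivial_subloop (L : loopType) (S : subloop L) : Prop :=
  (S : set L) <> [set 1].

Definition SWIPL (L : loopType) : Prop :=
  exists S : subloop L, nontrivial_subloop S /\ WIPL (subloop_type S).

Definition WIP_SWIPL (L : loopType) : Prop := WIPL L /\ SWIPL L.

Record Aum (L : loopType) := MkAum {
  aum_fun :> L -> L;
  aum_bij : bijective aum_fun;
  aumM : {morph aum_fun : x y / x * y}
}.

Section Automorphisms.
Variable L : loopType.
Implicit Types a b : Aum L.

HB.instance Definition _ := gen_eqMixin (Aum L).
HB.instance Definition _ := gen_choiceMixin (Aum L).

Lemma aumP a b : a =1 b -> a = b.
Proof.
case: a b => [f fb fM] [g gb gM] /= /funext fg; subst g.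
by rewrite (Prop_irrelevance gb fb) (Prop_irrelevance gM fM).
Qed.

Lemma aum1 a : a 1 = 1.
Proof. by apply: (@loop_mulgI L (a 1)); rewrite -aumM !mulg1. Qed.

Definition aum_one : Aum L :=
  @MkAum L id (Bijective (frefl id) (frefl id)) (fun _ _ => erefl).

Fact aum_mulM a b : {morph (b \o a) : x y / x * y}.
Proof. by move=> x y /=; rewrite !aumM. Qed.

(* Mappings act on the right: the product ab is first a, then b. *)
Definition aum_mul a b : Aum L :=
  MkAum (bij_comp (aum_bij b) (aum_bij a)) (aum_mulM a b).

Lemma aum_inv_ex a : exists b, cancel a b /\ cancel b a.
Proof.
have [g aK gK] := aum_bij a.
have gM : {morph g : x y / x * y}.
  by move=> x y; apply: (can_inj aK); rewrite aumM !gK.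
by exists (MkAum (Bijective gK aK) gM).
Qed.

End Automorphisms.

Definition holomorph (L : loopType) : Type := (Aum L * L)%type.

Section Holomorph.
Variable L : loopType.
Local Notation H := (holomorph L).

HB.instance Definition _ := Choice.on H.

Definition holo_one : H := (aum_one L, 1).

Definition holo_mul (X Y : H) : H :=
  (aum_mul X.1 Y.1, Y.1 X.2 * Y.2).

Fact holo_mul1g : left_id holo_one holo_mul.
Proof.
by case=> a x; rewrite /holo_mul /= aum1 mul1g; congr (_, _); apply: aumP.
Qed.

Fact holo_mulg1 : right_id holo_one holo_mul.
Proof.
by case=> a x; rewrite /holo_mul /= mulg1; congr (_, _); apply: aumP.
Qed.

HB.instance Definition _ := hasMul.Build H holo_mul.
HB.instance Definition _ := hasOne.Build H holo_one.
HB.instance Definition _ := BaseUMagma_isUMagma.Build H holo_mul1g holo_mulg1.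

Fact holo_eqr (X Z : H) : exists! Y : H, X * Y = Z.
Proof.
case: X Z => [a x] [c z]; have [a' [aK a'K]] := aum_inv_ex a.
have [y [yE yU]] := loop_eqr (aum_mul a' c x) z.
exists (aum_mul a' c, y); split.
  by congr (_, _) => //; apply: aumP => t /=; rewrite aK.
case=> b w [abc bxw].
have bE : b = aum_mul a' c.
  by apply: aumP => t; rewrite -abc /= a'K.
by subst b; congr (_, _); apply: yU.
Qed.

Fact holo_eql (X Z : H) : exists! Y : H, Y * X = Z.
Proof.
case: X Z => [a x] [c z]; have [a' [aK a'K]] := aum_inv_ex a.
have [y [yE yU]] := loop_eql x z.
exists (aum_mul c a', a' y); split.
  congr (_, _); first by apply: aumP => t /=; rewrite a'K.
  by rewrite /= a'K.
case=> b w [bac awx]; congr (_, _).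
  by apply: aumP => t; rewrite -bac /= aK.
by rewrite (yU _ awx) aK.
Qed.

HB.instance Definition _ := UMagma_isLoop.Build H holo_eqr holo_eql.
End Holomorph.

(* Main.v *)
From mathcomp Require Import all_boot.
From mathcomp Require Import boolp classical_sets.
Require Import Defs.

(** The weak inverse property says that a product [y x z] equal to 1 when
    bracketed as [(y x) z] is also equal to 1 when bracketed as [y (x z)]
    ([WIPLP]). This form mentions no inverses, so it restricts to subloops at
    once, and it passes between [L] and its holomorph: the automorphism
    components compose associatively, and applying automorphisms to the
    factors turns the second components of the two bracketings of
    [(b, y) (a, x) (c, z)] into the two bracketings of [c (a y)], [c x], [z]
    ([WIPL_holomorph]).

    In a WIPL every subloop, in particular the whole loop, is a WIPL; so a
    WIPL has a non-trivial WIP subloop if and only if it has an element other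
    than 1 ([WIP_SWIPLP]). The holomorph has such an element exactly when [L]
    does, because the only automorphism of a one-element loop is the identity
    ([holomorph_neq1]). *)

Local Open Scope group_scope.
Local Open Scope classical_set_scope.

Lemma rinv_uniq {L : loopType} (x y : L) : x * y = 1 -> y = rinv x.
Proof. by move=> xy1; apply: (@loop_mulgI L x); rewrite mulg_rinv. Qed.

(** Right inverses are unique, so the defining identity at [x], [y] only says
    that [x z] is a right inverse of [y] whenever [z] is one of [y x]. *)
Lemma WIPLP (L : loopType) :
  WIPL L <-> forall x y z : L, y * x * z = 1 -> y * (x * z) = 1.
Proof.
split=> [wipL x y z /rinv_uniq -> | wipL x y].
  by rewrite wipL mulg_rinv.
by apply: rinv_uniq; apply: wipL; rewrite mulg_rinv.
Qed.

Lemma WIPL_subloop {L : loopType} (S : subloop L) :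
  WIPL L -> WIPL (subloop_type S).
Proof.
move=> /WIPLP wipL; apply/WIPLP => x y z /(congr1 val) xyz1.
by apply: val_inj; apply: wipL.
Qed.

Lemma total_eqr {L : loopType} (a b : L) :
  setT a -> setT b -> exists2 x : L, setT x & a * x = b.
Proof. by move=> _ _; have [x [axb _]] := loop_eqr a b; exists x. Qed.

Lemma total_eql {L : loopType} (a b : L) :
  setT a -> setT b -> exists2 y : L, setT y & y * a = b.
Proof. by move=> _ _; have [y [yab _]] := loop_eql a b; exists y. Qed.

Definition total_subloop (L : loopType) : subloop L :=
  @Subloop L setT I (fun _ _ _ _ => I) total_eqr total_eql.

Lemma nontrivial_subloopP {L : loopType} (S : subloop L) :
  nontrivial_subloop S <-> exists2 x : L, (S : set L) x & x <> 1.
Proof.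
split=> [S_nt | [x Sx x_neq1] S1]; last by move: Sx; rewrite S1.
apply: contrapT => no_x; apply: S_nt; apply/seteqP; split=> [x Sx | x ->].
  by apply: contrapT => x_neq1; apply: no_x; exists x.
exact: subloop1.
Qed.

Lemma WIP_SWIPLP (L : loopType) :
  WIP_SWIPL L <-> WIPL L /\ exists x : L, x <> 1.
Proof.
split=> [[wipL [S [/nontrivial_subloopP [x _ x_neq1] _]]] | [wipL [x x_neq1]]].
  by split=> //; exists x.
split=> //; exists (total_subloop L); split; last exact: WIPL_subloop.
by apply/nontrivial_subloopP; exists x.
Qed.

(** Automorphisms compose associatively and distribute over products, so
    rebracketing in the holomorph is rebracketing in [L]. Conversely, [L] embeds
    in its holomorph as the pairs whose automorphism is the identity. *)
Lemma WIPL_holomorph (L : loopType) : WIPL L <-> WIPL (holomorph L).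
Proof.
split=> /WIPLP wip; apply/WIPLP.
  move=> [a x] [b y] [c z] [bac1 yxz1].
  congr (_, _).
    by apply: aumP => t; exact: (congr1 (@^~ t) bac1).
  (* [c] distributes over the product [a y * x]. *)
  by apply: wip; rewrite /= -aumM.
move=> x y z yxz1.
pose embed t : holomorph L := (aum_one L, t).
have embed_yxz1 : embed y * embed x * embed z = 1.
  by congr (_, _) => //; apply: aumP.
by case: (wip _ _ _ embed_yxz1).
Qed.

Lemma holomorph_neq1 (L : loopType) :
  (exists x : L, x <> 1) <-> (exists X : holomorph L, X <> 1).
Proof.
split=> [[x x_neq1] | [[a x] ax_neq1]].
  by exists (aum_one L, x) => -[].
apply: contrapT => L_trivial.
have eq1 t : t = 1 :> L.
  by apply: contrapT => t_neq1; apply: L_trivial; exists t.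
apply: ax_neq1; congr (_, _); last exact: eq1.
by apply: aumP => t; rewrite (eq1 (a t)) [RHS]eq1.
Qed.

Theorem theorem3p6 (L : loopType) : WIP_SWIPL L <-> WIP_SWIPL (holomorph L).
Proof.
split=> /WIP_SWIPLP [wip neq1]; apply/WIP_SWIPLP;
  by split; [apply/(WIPL_holomorph L) | apply/(holomorph_neq1 L)].
Qed.
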